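(* Let $k$ be a commutative associative unital ring with $1/2\in k$ and let $\mathbf J=(J,J)$ be the Jordan pair of a unital Jordan algebra $J$ over $k$. The map $\alpha:\mathbf J\diamond\mathbf J\to J*J$, $a\diamond b\mapsto a*b$, is a (well-defined) epimorphism of $k$-modules. A $k$-linear section of $\alpha$ is given by $\beta:a*b\mapsto a\diamond b-1\diamond ab$, so that there is a direct sum decomposition $\mathbf J\diamond\mathbf J=\beta(J*J)\oplus(1\diamond\mathbf J)$, where $1\diamond\mathbf J=\{1\diamond a:a\in J\}$.
   Context: $J$ is a unital Jordan algebra over $k$ with commutative product $ab$ (equivalently, since $1/2\in k$, a unital quadratic Jordan algebra with operator $U$, where $2ab=U_{a,b}1$). Its Jordan triple product is $\{a\,b\,c\}=U_{a,c}b=2(a(bc)+c(ba)-b(ca))$. The Jordan pair of $J$ is $\mathbf J=(\mathbf J^+,\mathbf J^-)=(J,J)$ with quadratic maps $Q_x=U_x$ and triple products $\{a\,b\,c\}$. $\mathbf J\diamond\mathbf J=\mathfrak{uider}(\mathbf J)$ is the quotient of $J\otimes_kJ$ (first factor $\mathbf J^+$, second factor $\mathbf J^-$) by the submodule generated by all $x\otimes\{y\,x\,y\}-\{x\,y\,x\}\otimes y$ and all $\{x\,y\,u\}\otimes w-u\otimes\{y\,x\,w\}-x\otimes\{w\,u\,y\}+\{u\,w\,x\}\otimes y$; $a\diamond b$ is the class of $a\otimes b$. $J*J$ is the quotient of $J\otimes_kJ$ by the submodule generated by all $a\otimes(bc)+b\otimes(ca)+c\otimes(ab)$ and all $a\otimes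 b+b\otimes a$; $a*b$ is the class of $a\otimes b$. *)

(* Defs.v *)
From HB Require Import structures.
From mathcomp Require Import all_boot all_order all_algebra ring_quotient.
From mathcomp Require Import boolp classical_sets functions cardinality.

Set Implicit Arguments.
Unset Strict Implicit.
Unset Printing Implicit Defensive.

Import GRing.Theory.
Local Open Scope classical_set_scope.
Local Open Scope quotient_scope.
Local Open Scope ring_scope.

(* `comPzRingType` rather than `comNzRingType`: the zero ring is allowed. *)

Section Submodules.
Variables (k : comPzRingType) (V : lmodType k).
Implicit Types A B G : set V.

Definition submodule A : Prop :=
  A 0 /\ forall (c : k) (u v : V), A u -> A v -> A (c *: u + v).

Definition span_submod G : {pred V} :=
  fun x => `[< forall A, submodule A -> G `<=` A -> A x >].

Lemma span_submod_closed G : submod_closed (span_submod G).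
Proof.
split=> [|c u v /asboolP hu /asboolP hv]; apply/asboolP => A sA GA.
  by case: sA.
by apply: (sA.2); [exact: hu | exact: hv].
Qed.

HB.instance Definition _ G :=
  GRing.isSubmodClosed.Build k V (span_submod G) (span_submod_closed G).

Definition direct_sum_decomposition A B : Prop :=
  [/\ submodule A, submodule B,
      forall x, exists a b, [/\ A a, B b & x = a + b]
    & A `&` B = [set 0]].

End Submodules.

Section QuotientModule.
Variables (k : comPzRingType) (V : lmodType k) (G : set V).

Definition quotmod : Type := Quotient.quot (span_submod G).
HB.instance Definition _ := GRing.Zmodule.on quotmod.

Definition quotmod_pi (x : V) : quotmod := \pi x.

Definition quotmod_scale (c : k) (q : quotmod) : quotmod :=
  quotmod_pi (c *: repr q).

Lemma quotmod_piP (x y : V) :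
  quotmod_pi x = quotmod_pi y <-> x - y \in span_submod G.
Proof.
rewrite (Quotient.idealrBE (span_submod G)).
by split=> [xy|/eqP]; [exact/eqP | ].
Qed.

Lemma quotmod_reprK (q : quotmod) : quotmod_pi (repr q) = q.
Proof. exact: reprK. Qed.

Lemma quotmod_piD (x y : V) :
  quotmod_pi (x + y) = quotmod_pi x + quotmod_pi y.
Proof. by rewrite /quotmod_pi; apply/esym; rewrite !piE. Qed.

Lemma quotmod_piZ (c : k) (x : V) :
  quotmod_scale c (quotmod_pi x) = quotmod_pi (c *: x).
Proof.
apply/quotmod_piP; rewrite -scalerBr rpredZ //.
by apply/quotmod_piP/quotmod_reprK.
Qed.

Fact quotmod_scaleA c d q :
  quotmod_scale c (quotmod_scale d q) = quotmod_scale (c * d) q.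
Proof. by rewrite -[q]quotmod_reprK !quotmod_piZ scalerA. Qed.
Fact quotmod_scale1 : left_id 1 quotmod_scale.
Proof. by move=> q; rewrite -[q]quotmod_reprK quotmod_piZ scale1r. Qed.
Fact quotmod_scaleDr : right_distributive quotmod_scale +%R.
Proof.
move=> c q r; rewrite -[q]quotmod_reprK -[r]quotmod_reprK.
by rewrite -quotmod_piD !quotmod_piZ scalerDr quotmod_piD.
Qed.
Fact quotmod_scaleDl q : {morph quotmod_scale^~ q : c d / c + d}.
Proof.
move=> c d; rewrite -[q]quotmod_reprK.
by rewrite !quotmod_piZ scalerDl quotmod_piD.
Qed.

HB.instance Definition _ := GRing.Zmodule_isLmodule.Build k quotmod
  quotmod_scaleA quotmod_scale1 quotmod_scaleDr quotmod_scaleDl.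

Fact quotmod_pi_is_linear : linear quotmod_pi.
Proof. by move=> c x y; rewrite quotmod_piD -quotmod_piZ. Qed.
HB.instance Definition _ :=
  GRing.isLinear.Build k V quotmod _ quotmod_pi quotmod_pi_is_linear.

Lemma quotmod_ext (W : lmodType k) (f g : {linear quotmod -> W}) :
  (forall x, f (quotmod_pi x) = g (quotmod_pi x)) -> f =1 g.
Proof. by move=> fg q; rewrite -[q]quotmod_reprK. Qed.

End QuotientModule.

Section FreeModule.
Variables (k : comPzRingType) (X : choiceType).

Definition finite_support : {pred X -> k^o} :=
  fun f => `[< finite_set [set x | f x != 0] >].

Fact finite_support_submod_closed : submod_closed finite_support.
Proof.
split=> [|c f g /asboolP hf /asboolP hg]; apply/asboolP.
  by rewrite (_ : [set _ | _] = set0) // -subset0 => x /=; rewrite eqxx.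
apply: (sub_finite_set _ (_ : finite_set ([set x | f x != 0] `|` [set x | g x != 0]))).
  move=> x /= ; apply: contraPP => /not_orP[/negP/negPn/eqP fx /negP/negPn/eqP gx].
  by apply/negP; rewrite negbK -[(c *: f + g) x]/(c *: f x + g x) fx gx scaler0 addr0.
by rewrite finite_setU.
Qed.
HB.instance Definition _ := GRing.isSubmodClosed.Build k (X -> k^o)
  finite_support finite_support_submod_closed.

Record freemod := Freemod { freemod_val : X -> k^o ; _ : freemod_val \in finite_support }.
HB.instance Definition _ := [isSub for freemod_val].
HB.instance Definition _ := [Choice of freemod by <:].
HB.instance Definition _ := [SubChoice_isSubLmodule of freemod by <:].

Fact freemod_basis_subproof (x : X) :
  (fun y => (y == x)%:R : k^o) \in finite_support.
Proof.
apply/asboolP/(sub_finite_set _ (finite_set1 x)) => y /=.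
by have [->|] := eqVneq y x; rewrite // eqxx.
Qed.
Definition freemod_basis (x : X) : freemod := Freemod (freemod_basis_subproof x).

Lemma freemod_ext (W : lmodType k) (f g : {linear freemod -> W}) :
  (forall x, f (freemod_basis x) = g (freemod_basis x)) -> f =1 g.
Proof.
move=> fg u.
have /asboolP/finite_seqP[s sP] := valP u.
suff -> : u = \sum_(x <- undup s) freemod_val u x *: freemod_basis x.
  by rewrite !linear_sum; apply: eq_bigr => x _; rewrite !linearZ fg.
apply/val_inj; rewrite raddf_sum; apply/funext => y; rewrite fct_sumE.
have us := undup_uniq s.
rewrite [RHS](eq_bigr (fun x => freemod_val u x * (y == x)%:R)) //.
have sE : (y \in undup s) = (freemod_val u y != 0).
  rewrite mem_undup; apply/idP/idP => [ys|uy].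
    by have : [set` s] y by []; rewrite -sP.
  by have : [set` s] y by rewrite -sP.
have [ys|] := boolP (y \in undup s).
  rewrite (bigD1_seq y) //= eqxx mulr1 big1 ?addr0 // => x /negPf xy.
  by rewrite eq_sym xy mulr0.
rewrite sE negbK => /eqP uy.
rewrite big1 // => x _; have [<-|] := eqVneq y x; last by rewrite mulr0.
by rewrite mulr1 uy.
Qed.

End FreeModule.

Section TensorProduct.
Variables (k : comPzRingType) (V W : lmodType k).

Local Notation e x y := (freemod_basis k ((x, y) : V * W)).

Inductive tensor_rel : freemod k (V * W)%type -> Prop :=
| Tensor_addl x x' y : tensor_rel (e (x + x') y - (e x y + e x' y))
| Tensor_addr x y y' : tensor_rel (e x (y + y') - (e x y + e x y'))
| Tensor_scalel c x y : tensor_rel (e (c *: x) y - c *: e x y)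
| Tensor_scaler c x y : tensor_rel (e x (c *: y) - c *: e x y).

Definition tensor : Type := quotmod tensor_rel.
HB.instance Definition _ := GRing.Lmodule.on tensor.

Definition tens (x : V) (y : W) : tensor := quotmod_pi tensor_rel (e x y).

Lemma tensor_ext (M : lmodType k) (f g : {linear tensor -> M}) :
  (forall x y, f (tens x y) = g (tens x y)) -> f =1 g.
Proof.
move=> fg; apply: quotmod_ext.
apply: (@freemod_ext _ _ _ (f \o quotmod_pi tensor_rel) (g \o quotmod_pi tensor_rel)).
by case=> x y; exact: fg.
Qed.

End TensorProduct.

Section UniversalInnerDerivations.
Variables (k : comPzRingType) (Vp Vm : lmodType k).
(* The quadratic maps Q_x y of a Jordan pair (Vp, Vm), in both signs.  The
   module uider depends on the pair only through Vp, Vm and these maps. *)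
Variables (Qp : Vp -> Vm -> Vp) (Qm : Vm -> Vp -> Vm).

Definition triple (X Y : lmodType k) (Q : X -> Y -> X) (x : X) (y : Y) (z : X) : X :=
  Q (x + z) y - Q x y - Q z y.

Local Notation "{+ x , y , z }" := (triple Qp x y z).
Local Notation "{- x , y , z }" := (triple Qm x y z).

Inductive uider_rel : tensor Vp Vm -> Prop :=
| Uider_quad x y :
    uider_rel (tens x {- y, x, y} - tens {+ x, y, x} y)
| Uider_lin x u y w :
    uider_rel (tens {+ x, y, u} w - tens u {- y, x, w}
               - tens x {- w, u, y} + tens {+ u, w, x} y).

Definition uider : Type := quotmod uider_rel.
HB.instance Definition _ := GRing.Lmodule.on uider.

End UniversalInnerDerivations.

(* Linear Jordan algebras; as usual this notion is the right one only over
   scalars containing 1/2, which is assumed separately where it is needed. *)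
HB.mixin Record Lmodule_isJordan (k : comPzRingType) J of GRing.Lmodule k J := {
  jmul : J -> J -> J;
  jone : J;
  jmul_linearl : forall (c : k) (x y z : J),
    jmul (c *: x + y) z = c *: jmul x z + jmul y z;
  jmulC : commutative jmul;
  jmul1 : left_id jone jmul;
  jordan_identity : forall a b : J,
    jmul (jmul (jmul a a) b) a = jmul (jmul a a) (jmul b a)
}.

#[short(type="jordanType")]
HB.structure Definition Jordan (k : comPzRingType) :=
  {J of GRing.Lmodule k J & Lmodule_isJordan k J}.

Arguments jone {k s} : rename.

Reserved Notation "a *j b" (at level 40, left associativity).
Notation "a *j b" := (jmul a b) : ring_scope.

Fact jtriple_cancel (V : zmodType) (p A B q M N L : V) :
  p + A + (B + q) - (M + N + (N + L)) - (p - M) - (q - L) = A + B - N *+ 2.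
Proof.
rewrite mulr2n !opprD !opprK.
rewrite [LHS](AC ((((2*2)*(2*2))*2)*2)
  ((2*3*(6*7))*((1*9)*(4*11)*(10*5)*(12*8)))) /=.
by rewrite !subrr !addr0.
Qed.

Section JordanPairOfAlgebra.
Variables (k : comPzRingType) (J : jordanType k).
Implicit Types a b c : J.

(* The Jordan pair of J is (J, J) with Q_x = jU x in both signs. *)
Definition jU a b : J := (a *j (a *j b)) *+ 2 - (a *j a) *j b.

Lemma jmulDl a b c : (a + b) *j c = a *j c + b *j c.
Proof. by rewrite -[a]scale1r jmul_linearl !scale1r. Qed.

Lemma jmulDr a b c : a *j (b + c) = a *j b + a *j c.
Proof. by rewrite jmulC jmulDl ![_ *j a]jmulC. Qed.

Lemma jtripleE a b c :
  triple jU a b c = (a *j (b *j c) + c *j (b *j a) - b *j (c *j a)) *+ 2.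
Proof.
rewrite /triple /jU !(jmulDl, jmulDr) !(jmulC c b) !(jmulC b a) !(jmulC c a).
by rewrite (jmulC b (a *j c)) !mulrnDl mulNrn jtriple_cancel.
Qed.

Definition jdiamond : Type := uider jU jU.
HB.instance Definition _ := GRing.Lmodule.on jdiamond.

Definition dia a b : jdiamond := quotmod_pi (uider_rel jU jU) (tens a b).

Inductive jstar_rel : tensor J J -> Prop :=
| Jstar_cyclic a b c :
    jstar_rel (tens a (b *j c) + tens b (c *j a) + tens c (a *j b))
| Jstar_alt a b : jstar_rel (tens a b + tens b a).

Definition jstar : Type := quotmod jstar_rel.
HB.instance Definition _ := GRing.Lmodule.on jstar.

Definition star a b : jstar := quotmod_pi jstar_rel (tens a b).

(* The classes dia a b (resp. star a b) generate, so a linear map out of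
   jdiamond (resp. jstar) is determined by its values on them. *)
Lemma dia_ext (M : lmodType k) (f g : {linear jdiamond -> M}) :
  (forall a b, f (dia a b) = g (dia a b)) -> f =1 g.
Proof.
move=> fg; apply: quotmod_ext.
exact: (@tensor_ext _ _ _ _ (f \o quotmod_pi _) (g \o quotmod_pi _)).
Qed.

Lemma star_ext (M : lmodType k) (f g : {linear jstar -> M}) :
  (forall a b, f (star a b) = g (star a b)) -> f =1 g.
Proof.
move=> fg; apply: quotmod_ext.
exact: (@tensor_ext _ _ _ _ (f \o quotmod_pi _) (g \o quotmod_pi _)).
Qed.

End JordanPairOfAlgebra.

(* Main.v *)
(* The relations of J * J say that star is alternating and cyclic; cyclicity
   gives (xp) * u - x * (up) = p * (ux), and with this the twelve terms of a
   defining relation of the diamond module cancel in pairs, so alpha exists.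
   Conversely, those relations at x = u = 1 and at y = 1 compute
   dia a b + dia b a and the cyclic sum of dia a (bc) as elements of the form
   dia 1 c, which is what makes a * b |-> dia a b - dia 1 (ab) well defined.
   Since 1 * a = 0, beta is a section of alpha whose defect is dia 1 (ab). *)
From HB Require Import structures.
Require Import Defs.
From mathcomp Require Import all_boot all_order all_algebra.
From mathcomp Require Import boolp classical_sets.
From mathcomp Require Import cardinality fsbigop.
Import GRing.Theory.

Set Implicit Arguments.
Unset Strict Implicit.
Unset Printing Implicit Defensive.

Local Open Scope classical_set_scope.
Local Open Scope ring_scope.

(** * Linear maps, submodules, and maps out of quotients and free modules *)

Lemma linear_bundle (k : comPzRingType) (V W : lmodType k) (f : V -> W) :
  linear f -> exists g : {linear V -> W}, g =1 f.
Proof.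
move=> lf; pose F := GRing.isLinear.Build k V W _ f lf.
by pose g : {linear V -> W} := HB.pack f F; exists g.
Qed.

(** All uses of 1/2 pass through this cancellation: it removes the common factor 2 from the diamond
    relations and turns [star a a = - star a a] into [star a a = 0]. *)
Lemma mulr2n_inj (k : comPzRingType) (V : lmodType k) :
  (exists h : k, 2%:R * h = 1) -> injective (fun v : V => v *+ 2).
Proof.
move=> [h h2] u v /= uv; rewrite -[u]scale1r -[v]scale1r -h2 mulrC.
by rewrite -!scalerA !scaler_nat uv.
Qed.

Section Submodules.
Variables (k : comPzRingType) (V : lmodType k).

Lemma span_submod_gen (G : set V) x : G x -> x \in span_submod G.
Proof. by move=> Gx; apply/asboolP => A _; apply. Qed.

Lemma span_submod_id (A : set V) x : submodule A -> x \in span_submod A -> A x.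
Proof. by move=> sA /asboolP; apply. Qed.

Lemma submodule_range (W : lmodType k) (f : W -> V) :
  linear f -> submodule (range f).
Proof.
move=> /linear_bundle[g gf]; split; first by exists 0; rewrite // -gf linear0.
by move=> c _ _ [u _ <-] [v _ <-]; exists (c *: u + v); rewrite // -!gf linearP.
Qed.

Lemma quotmod_pi_gen (G : set V) x : G x -> quotmod_pi G x = 0.
Proof.
move=> Gx; rewrite -(linear0 (quotmod_pi G)); apply/quotmod_piP.
by rewrite subr0 span_submod_gen.
Qed.

(** The kernel of [f] is a submodule containing [G], hence contains its span; so [f (repr q)] does
    not depend on the representative and is linear in [q]. *)
Lemma quotmod_lift (G : set V) (W : lmodType k) (f : {linear V -> W}) :
  (forall x, G x -> f x = 0) ->
  exists g : {linear quotmod G -> W}, forall x, g (quotmod_pi G x) = f x.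
Proof.
move=> fG.
have fspan x : x \in span_submod G -> f x = 0.
  move=> /asboolP/(_ [set v | f v = 0]); apply; last exact: fG.
  split=> [|c u v /= fu fv]; first exact: linear0.
  by rewrite linearP fu fv scaler0 addr0.
have fE x y : quotmod_pi G x = quotmod_pi G y -> f x = f y.
  by move=> /quotmod_piP/fspan/eqP; rewrite linearB subr_eq0 => /eqP.
have [|g gE] := @linear_bundle k (quotmod G) W (fun q => f (repr q)).
  move=> c q r; rewrite -linearP; apply: fE.
  by rewrite quotmod_reprK linearP /= !quotmod_reprK.
by exists g => x; rewrite gE; apply/fE/quotmod_reprK.
Qed.

Lemma freemod_lift (X : choiceType) (f : X -> V) :
  exists g : {linear freemod k X -> V}, forall x, g (freemod_basis k x) = f x.
Proof.
pose F (u : freemod k X) := \sum_(x \in setT) freemod_val u x *: f x.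
(* The sum may be taken over any duplicate-free list covering the support, so linearity can be
   checked on one list common to [u] and [v]. *)
have FE (u : freemod k X) s : uniq s ->
    {subset [pred x | freemod_val u x != 0] <= s} ->
    F u = \sum_(x <- s) freemod_val u x *: f x.
  move=> us su; rewrite fsbig_seq //; apply/esym/fsbig_widen => // x [_ /= xs].
  have [->|/su] := eqVneq (freemod_val u x) 0; first by rewrite scale0r.
  by move=> /xs.
have supp (u : freemod k X) : exists s : seq X,
    {subset [pred x | freemod_val u x != 0] <= s}.
  have /asboolP/finite_seqP[s sE] := valP u; exists s => x /= ux.
  by have : [set` s] x by rewrite -sE.
have [|g gE] := @linear_bundle k _ V F.
  move=> c u v; have [s su] := supp u; have [t tv] := supp v.
  have uniq_st := undup_uniq (s ++ t).
  have su' : {subset [pred x | freemod_val u x != 0] <= undup (s ++ t)}.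
    by move=> x /su xs; rewrite mem_undup mem_cat xs.
  have tv' : {subset [pred x | freemod_val v x != 0] <= undup (s ++ t)}.
    by move=> x /tv xs; rewrite mem_undup mem_cat xs orbT.
  have E x : freemod_val (c *: u + v) x = c * freemod_val u x + freemod_val v x.
    by [].
  rewrite (FE u _ uniq_st su') (FE v _ uniq_st tv') (FE _ _ uniq_st).
    rewrite scaler_sumr -big_split; apply: eq_bigr => x _.
    by rewrite E scalerDl scalerA.
  move=> x; rewrite inE E; apply: contraR => xst.
  have /negbNE/eqP-> := contra (su' x) xst.
  by have /negbNE/eqP-> := contra (tv' x) xst; rewrite mulr0 addr0.
exists g => x; rewrite gE (FE _ [:: x]) //.
  by rewrite big_seq1 /= eqxx scale1r.
by move=> y; rewrite !inE /=; case: (y == x); rewrite ?eqxx.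
Qed.

End Submodules.

(** * Bilinear maps and the universal property of the tensor product *)

Section BilinearMaps.
Variables (k : comPzRingType) (V W M : lmodType k).

Definition bilinear_map (B : V -> W -> M) :=
  (forall y, linear (B^~ y)) /\ (forall x, linear (B x)).

Lemma tensor_lift (B : V -> W -> M) : bilinear_map B ->
  exists g : {linear tensor V W -> M}, forall x y, g (tens x y) = B x y.
Proof.
move=> [Bl Br]; have [f fE] := freemod_lift (fun p : V * W => B p.1 p.2).
have [|g gE] := @quotmod_lift _ _ (@tensor_rel k V W) _ f; last first.
  by exists g => x y; rewrite gE fE.
move=> _ [x x' y|x y y'|c x y|c x y]; rewrite linearB; apply/eqP;
  rewrite subr_eq0 ?linearD ?linearZ /= !fE /=; apply/eqP.
- by have [b bE] := linear_bundle (Bl y); rewrite -!bE linearD.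
- by have [b bE] := linear_bundle (Br x); rewrite -!bE linearD.
- by have [b bE] := linear_bundle (Bl y); rewrite -!bE linearZ.
- by have [b bE] := linear_bundle (Br x); rewrite -!bE linearZ.
Qed.

Variables (B : V -> W -> M) (bB : bilinear_map B).

Lemma bilDl x x' y : B (x + x') y = B x y + B x' y.
Proof. by have [b bE] := linear_bundle (bB.1 y); rewrite -!bE linearD. Qed.
Lemma bilBl x x' y : B (x - x') y = B x y - B x' y.
Proof. by have [b bE] := linear_bundle (bB.1 y); rewrite -!bE linearB. Qed.
Lemma bilMnl x y n : B (x *+ n) y = B x y *+ n.
Proof. by have [b bE] := linear_bundle (bB.1 y); rewrite -!bE linearMn. Qed.
Lemma bilDr x y y' : B x (y + y') = B x y + B x y'.
Proof. by have [b bE] := linear_bundle (bB.2 x); rewrite -!bE linearD. Qed.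
Lemma bilBr x y y' : B x (y - y') = B x y - B x y'.
Proof. by have [b bE] := linear_bundle (bB.2 x); rewrite -!bE linearB. Qed.
Lemma bilMnr x y n : B x (y *+ n) = B x y *+ n.
Proof. by have [b bE] := linear_bundle (bB.2 x); rewrite -!bE linearMn. Qed.

End BilinearMaps.

Lemma tens_bilinear (k : comPzRingType) (V W : lmodType k) :
  bilinear_map (@tens k V W).
Proof.
split=> [y c x x'|x c y y'].
- have addl := quotmod_pi_gen (Tensor_addl (c *: x) x' y).
  have scll := quotmod_pi_gen (Tensor_scalel c x y).
  move: addl scll; rewrite !linearB linearD linearZ => /subr0_eq + /subr0_eq.
  by rewrite /tens => -> ->.
- have addr := quotmod_pi_gen (Tensor_addr x (c *: y) y').
  have sclr := quotmod_pi_gen (Tensor_scaler c x y).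
  move: addr sclr; rewrite !linearB linearD linearZ => /subr0_eq + /subr0_eq.
  by rewrite /tens => -> ->.
Qed.

Lemma bilinear_map_comp (k : comPzRingType) (V W M N : lmodType k)
    (f : {linear M -> N}) (B : V -> W -> M) :
  bilinear_map B -> bilinear_map (fun x y => f (B x y)).
Proof.
by move=> [Bl Br]; split=> [y|x] c u v; rewrite (Bl, Br) linearP.
Qed.

(** * The relations of the diamond module hold for [star] *)

Section JordanStar.
Variables (k : comPzRingType) (J : jordanType k).
Hypothesis half_in_k : exists h : k, 2%:R * h = 1.
Implicit Types a b c x y u w p : J.

Lemma jmulr1 a : a *j jone = a.
Proof. by rewrite jmulC jmul1. Qed.

Lemma star_bilinear : bilinear_map (@star k J).
Proof. exact: (bilinear_map_comp (quotmod_pi _) (tens_bilinear _ _)). Qed.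
Let starDl := bilDl star_bilinear.
Let starBl := bilBl star_bilinear.
Let starMnl := bilMnl star_bilinear.
Let starDr := bilDr star_bilinear.
Let starBr := bilBr star_bilinear.
Let starMnr := bilMnr star_bilinear.

Lemma star_anti a b : star a b = - star b a.
Proof.
apply/eqP; rewrite -addr_eq0; apply/eqP.
by have := quotmod_pi_gen (Jstar_alt a b); rewrite linearD.
Qed.

Lemma star_cyclic a b c :
  star a (b *j c) + star b (c *j a) + star c (a *j b) = 0.
Proof. by have := quotmod_pi_gen (Jstar_cyclic a b c); rewrite !linearD. Qed.

Lemma starxx a : star a a = 0.
Proof.
apply: (mulr2n_inj half_in_k); rewrite mul0rn mulr2n {1}star_anti.
exact: addNr.
Qed.

(** The cyclic relation at (a, 1, 1) reads a * 1 + 1 * a + 1 * a = 0, and the first two terms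
    cancel. *)
Lemma star1 a : star jone a = 0.
Proof.
have := star_cyclic a jone jone.
by rewrite jmulr1 !jmul1 jmulr1 [star a _]star_anti addNr add0r.
Qed.

(** Carries a factor [p] across [star] at the cost of one term: it is the cyclic relation of x, u, p
    with u * (px) rewritten as - (px) * u. *)
Lemma star_mull x u p : star (x *j p) u - star x (u *j p) = star p (u *j x).
Proof.
have := star_cyclic x u p.
rewrite [star u _]star_anti (jmulC p x) (jmulC x u) addrAC => /subr0_eq <-.
by rewrite addrAC subrr add0r.
Qed.

Lemma star_mulr x u p : star x (u *j p) + star u (x *j p) = - star p (u *j x).
Proof.
by apply/eqP; rewrite -addr_eq0 (jmulC x p) (jmulC u x) star_cyclic.
Qed.

(** The letters p, q, r, s stand for the terms of the four triple products in the linear diamond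
    relation, in order. The differences have the shape of [star_mull]; the two sums of third terms
    are handled by [star_mulr]. *)
Lemma sum12_regroup (V : zmodType) (p1 p2 p3 q1 q2 q3 r1 r2 r3 s1 s2 s3 : V) :
  p1 + p2 - p3 - (q1 + q2 - q3) - (r1 + r2 - r3) + (s1 + s2 - s3) =
  ((p1 - r1) + (s1 - q1)) + ((p2 - q2) + (s2 - r2)) + ((q3 + r3) - (p3 + s3)).
Proof.
rewrite !opprD !opprK.
by rewrite [LHS](AC (3*3*3*3)
  (((1*7)*(10*4))*((2*5)*(11*8))*((6*9)*(3*12)))).
Qed.

Lemma star_quad x y : star x (triple (@jU k J) y x y) =
  star (triple (@jU k J) x y x) y.
Proof.
rewrite !jtripleE starMnl starMnr; congr (_ *+ 2).
(* [star_mull] with p = xy leaves the difference (xy) * (xy), which is 0. *)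
have xyxy : star x (y *j (x *j y)) = star (x *j (y *j x)) y.
  apply/esym/eqP; rewrite -subr_eq0 (jmulC x y); apply/eqP.
  by rewrite star_mull starxx.
(* Doubled, both sides equal - (yy) * (xx) by [star_mulr]. *)
have xxyy : star x (x *j (y *j y)) = star (y *j (x *j x)) y.
  apply: (mulr2n_inj half_in_k); rewrite /= !mulr2n star_mulr.
  by rewrite [star (y *j _) y]star_anti -opprD star_mulr opprK -star_anti.
by rewrite starBr starBl starDr starDl xyxy xxyy.
Qed.

Lemma star_jordan_pair x y u w :
  star (triple (@jU k J) x y u) w - star u (triple (@jU k J) y x w)
    - star x (triple (@jU k J) w u y) + star (triple (@jU k J) u w x) y = 0.
Proof.
rewrite !jtripleE !starMnl !starMnr -!mulrnBl -mulrnDl.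
rewrite [X in X *+ 2](_ : _ = 0) ?mul0rn //.
rewrite !(starBr, starBl, starDr, starDl).
rewrite sum12_regroup.
have anti a b : star a b + star b a = 0 by rewrite star_anti addNr.
(* The four differences become (yu) * (wx), (wx) * (yu), (yx) * (wu) and (wu) * (yx), which cancel
   in pairs. *)
rewrite (jmulC u y) (jmulC x w) (jmulC x y) (jmulC u w) !star_mull !anti !add0r.
(* Both remaining sums of third terms equal (ux) * (wy). *)
have -> : star u (x *j (w *j y)) + star x (u *j (y *j w)) = star (u *j x) (w *j y).
  by rewrite (jmulC y w) star_mulr -star_anti (jmulC x u).
have -> : star (y *j (u *j x)) w + star (w *j (x *j u)) y = star (u *j x) (w *j y).
  rewrite [star _ w]star_anti [star _ y]star_anti -opprD (jmulC x u) star_mulr.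
  by rewrite opprK (jmulC y w).
exact: subrr.
Qed.

End JordanStar.

(** * Symmetry and cyclicity in the diamond module, modulo elements [dia jone c] *)

Section JordanDiamond.
Variables (k : comPzRingType) (J : jordanType k).
Hypothesis half_in_k : exists h : k, 2%:R * h = 1.
Implicit Types a b c x y u w : J.

Lemma dia_bilinear : bilinear_map (@dia k J).
Proof. exact: (bilinear_map_comp (quotmod_pi _) (tens_bilinear _ _)). Qed.

Lemma dia_lin x u y w :
  dia (triple (@jU k J) x y u) w - dia u (triple (@jU k J) y x w)
    - dia x (triple (@jU k J) w u y) + dia (triple (@jU k J) u w x) y = 0.
Proof.
have := quotmod_pi_gen (Uider_lin (@jU k J) (@jU k J) x u y w).
by rewrite linearD !linearB.
Qed.

Lemma jtriple1l a b : triple (@jU k J) jone a b = (a *j b) *+ 2.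
Proof. by rewrite jtripleE jmul1 jmulr1 (jmulC b a) jmulr1 addrK. Qed.

Lemma jtriple1m a b : triple (@jU k J) a jone b = (a *j b) *+ 2.
Proof. by rewrite jtripleE !jmul1 (jmulC b a) addrK. Qed.

Lemma jtriple1r a b : triple (@jU k J) a b jone = (a *j b) *+ 2.
Proof. by rewrite jtripleE !jmul1 jmulr1 (jmulC b a) addrK. Qed.

(** With x = u = 1, y = a, w = b, the linear relation is twice this identity: its outer terms give
    [dia a b] and [dia b a], and each inner term gives [dia jone (a *j b)], all with a factor 2. *)
Lemma dia_sym a b : dia a b + dia b a = dia jone (a *j b) *+ 2.
Proof.
apply: (mulr2n_inj half_in_k).
have := dia_lin jone jone a b.
rewrite !jtriple1m !jtriple1l !jmulr1.
rewrite !(bilMnl dia_bilinear) !(bilMnr dia_bilinear) (jmulC b a).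
rewrite -[_ - _ - _]addrA -opprD addrAC => /subr0_eq.
by rewrite -mulrnDl.
Qed.

Lemma dia1 a : dia a jone = dia jone a.
Proof.
have := dia_sym a jone; rewrite jmulr1 mulr2n.
exact: addIr.
Qed.

(** The linear relation at x = a, u = b, y = 1, w = c has last term [dia (triple b c a) jone], which
    [dia1] moves to the form [dia jone _]. After halving, [dia_sym] flips [dia (a *j b) c], the only
    term in the wrong order. *)
Lemma dia_cyclic a b c :
  dia a (b *j c) + dia b (c *j a) + dia c (a *j b) =
  dia jone (a *j (b *j c)) + dia jone (b *j (c *j a)) + dia jone (c *j (a *j b)).
Proof.
have := dia_lin a b jone c.
rewrite jtriple1m jtriple1l jtriple1r jtripleE dia1.
rewrite !(bilMnl dia_bilinear) !(bilMnr dia_bilinear).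
rewrite -!mulrnBl -mulrnDl (bilBr dia_bilinear) (bilDr dia_bilinear).
rewrite -[RHS](mul0rn _ 2) => /(mulr2n_inj half_in_k).
have -> : dia (a *j b) c = dia jone (c *j (a *j b)) *+ 2 - dia c (a *j b).
  by rewrite (jmulC c) -dia_sym addrK.
rewrite (jmulC a c) (jmulC c b) mulr2n [LHS](AC (5*3)
  (((7*6*1)*((5*4)*3))*(2*8))) /= subrr addr0 -!opprD.
by move=> /subr0_eq ->.
Qed.

(** * Existence of alpha and beta *)

Lemma diamond_to_star : exists alpha : {linear jdiamond J -> jstar J},
  forall a b, alpha (dia a b) = star a b.
Proof.
have [|f fE] := @quotmod_lift _ _ (uider_rel (@jU k J) (@jU k J)) _
  (quotmod_pi (@jstar_rel k J)); last by exists f => a b; apply: fE.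
move=> _ [x y|x u y w].
  by rewrite linearB -[LHS]/(star _ _ - star _ _) star_quad ?subrr.
by rewrite linearD !linearB; apply: star_jordan_pair.
Qed.

Lemma star_to_diamond : exists beta : {linear jstar J -> jdiamond J},
  forall a b, beta (star a b) = dia a b - dia jone (a *j b).
Proof.
have bB : bilinear_map (fun a b => dia a b - dia jone (a *j b)).
  have [dl dr] := dia_bilinear; split=> [y|x] c u v.
    by rewrite dl jmul_linearl dr scalerBr opprD addrACA.
  by rewrite dr jmulC jmul_linearl dr !(jmulC _ x) scalerBr opprD addrACA.
have [f fE] := tensor_lift bB.
have [|g gE] := @quotmod_lift _ _ (@jstar_rel k J) _ f; last first.
  by exists g => a b; rewrite gE fE.
move=> _ [a b c|a b].
  (* The three corrections [dia jone _] add up to the right-hand side of [dia_cyclic]. *)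
  rewrite !linearD !fE [X in X + _]addrACA -opprD addrACA -opprD dia_cyclic.
  exact: subrr.
by rewrite linearD !fE addrACA -opprD dia_sym (jmulC b) -mulr2n subrr.
Qed.

End JordanDiamond.

Theorem lemma6p5p6 (k : comPzRingType) (half_in_k : exists h : k, 2%:R * h = 1)
    (J : jordanType k) :
  exists (alpha : {linear jdiamond J -> jstar J})
         (beta : {linear jstar J -> jdiamond J}),
    [/\ forall a b : J, alpha (dia a b) = star a b,
        forall s : jstar J, exists d : jdiamond J, alpha d = s,
        forall a b : J, beta (star a b) = dia a b - dia jone (a *j b),
        forall s : jstar J, alpha (beta s) = s
      & direct_sum_decomposition (range beta) (range (dia (jone : J)))].
Proof.
have [alpha alphaE] := diamond_to_star J half_in_k.
have [beta betaE] := star_to_diamond J half_in_k.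
have alphaK s : alpha (beta s) = s.
  move: s; apply: (@star_ext _ _ _ (alpha \o beta) idfun) => a b /=.
  by rewrite betaE linearB !alphaE star1 subr0.
have sub_beta : submodule (range beta).
  by apply: submodule_range => c u v; exact: linearP.
have sub_dia1 : submodule (range (dia (jone : J))).
  by apply: submodule_range; case: (dia_bilinear J).
exists alpha, beta; split=> //; first by move=> s; exists (beta s).
split=> //.
- move=> d; exists (beta (alpha d)), (d - beta (alpha d)).
  split; [by exists (alpha d) | | by rewrite addrC subrK].
  (* Membership of d - beta (alpha d) in 1 ⋄ J becomes an equality of two linear maps into the
     quotient by 1 ⋄ J, so generators suffice; on [dia a b] the defect is [dia jone (a *j b)]. *)
  apply: span_submod_id => //; apply/quotmod_piP; move: d.
  pose p := quotmod_pi (range (dia (jone : J))).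
  apply: (@dia_ext _ _ _ p (p \o beta \o alpha)) => a b /=.
  rewrite alphaE betaE; apply/quotmod_piP; rewrite opprB addrC subrK.
  by apply: span_submod_gen; exists (a *j b).
- apply/seteqP; split=> [_ [[s _ <-] [a _ sE]]|_ ->] /=.
    (* If beta s = 1 ⋄ a, applying alpha gives s = 1 * a = 0. *)
    by rewrite -(alphaK s) -sE alphaE star1 linear0.
  by split; [exact: sub_beta.1 | exact: sub_dia1.1].
Qed.
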